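(* There exists a function $f:[0,1]^2\to\mathbb{R}$ satisfying the following conditions: (i) $f$ is separately infinitely differentiable; (ii) $\displaystyle\sup_{y\in[0,1]}\int_0^1|f''_{xx}(x,y)|\,dx=\sup_{x\in[0,1]}\int_0^1|f''_{yy}(x,y)|\,dy<\infty$; (iii) there is a closed set $E\subseteq[0,1]^2$ of positive Lebesgue measure such that each of $f'_x$ and $f'_y$ is jointly discontinuous at every point of $E$.
   Context: Separately infinitely differentiable means that for every $y\in[0,1]$ the function $x\mapsto f(x,y)$ is infinitely differentiable on $[0,1]$, and for every $x\in[0,1]$ the function $y\mapsto f(x,y)$ is infinitely differentiable on $[0,1]$ (one-sided derivatives at endpoints). A function on $[0,1]^2$ is jointly discontinuous at a point if it is not continuous at that point as a function of two variables. *)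

(* Defs.v *)
From HB Require Import structures.
From mathcomp Require Import all_boot all_order all_algebra.
From mathcomp Require Import all_classical all_reals all_analysis.

Set Implicit Arguments.
Unset Strict Implicit.
Unset Printing Implicit Defensive.

Import Order.TTheory GRing.Theory Num.Theory.
Import numFieldNormedType.Exports.

Local Open Scope classical_set_scope.
Local Open Scope ring_scope.

(* The library's derivatives are two-sided, so differentiability on [0, 1],
   one-sided at the endpoints, is expressed relative to a domain D: only the
   values of g on D matter. Similarly, functions on [0, 1]^2 are represented
   by total functions R * R -> R whose values off the square are never used. *)

Definition slopes_within (R : realType) (D : set R) (g : R -> R) (x : R) :
    set_system R :=
  (fun y => (g y - g x) / (y - x)) @ within D x^'.

Definition derivable_within (R : realType) (D : set R) (g : R -> R) (x : R) :=
  cvg (slopes_within D g x).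

Definition derive_within (R : realType) (D : set R) (g : R -> R) (x : R) : R :=
  lim (slopes_within D g x).

Definition deriven_within (R : realType) (D : set R) (n : nat) (g : R -> R) :
    R -> R :=
  iter n (derive_within D) g.

Definition smooth_within (R : realType) (D : set R) (g : R -> R) :=
  forall (n : nat) (x : R), D x -> derivable_within D (deriven_within D n g) x.

Definition unit_itv (R : realType) : set R := `[0, 1].
Arguments unit_itv : clear implicits.

Definition unit_square (R : realType) : set (R * R) :=
  unit_itv R `*` unit_itv R.
Arguments unit_square : clear implicits.

Definition partialx (R : realType) (n : nat) (f : R * R -> R) (p : R * R) : R :=
  deriven_within (unit_itv R) n (fun x => f (x, p.2)) p.1.

Definition partialy (R : realType) (n : nat) (f : R * R -> R) (p : R * R) : R :=
  deriven_within (unit_itv R) n (fun y => f (p.1, y)) p.2.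

Definition separately_smooth (R : realType) (f : R * R -> R) :=
  (forall y, unit_itv R y -> smooth_within (unit_itv R) (fun x => f (x, y))) /\
  (forall x, unit_itv R x -> smooth_within (unit_itv R) (fun y => f (x, y))).

Definition jointly_discontinuous_at (R : realType) (g : R * R -> R)
    (p : R * R) :=
  ~ (g @ within (unit_square R) (nbhs p) --> g p).

(* Main.v *)
(* Fix a compact set K of irrational numbers of ]0, 1[ of positive measure, and
   put E = K * K. A greedy choice gives pairwise disjoint balls of ]0, 1[ off K,
   grouped in pairs of equal radius d, such that every point of E is a limit of
   products of paired balls. On the product of two paired balls, centred at a
   and b, let f(x, y) = d B((x - a)/d) B((y - b)/d) for a smooth bump B
   supported in [-1, 1], and let f = 0 elsewhere. Any horizontal or vertical
   line meets at most one such product, so f is separately smooth, and rescaling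
   shows that the integrals of |f_xx| are uniformly bounded and that f_x takes
   the same nonzero value B(1/2) B'(1/2) in each product, whereas f_x = 0 on E.
   Both orders of each pair are used, so f(x, y) = f(y, x): the two suprema
   coincide and f_y behaves like f_x. *)
Require Import Defs.
From HB Require Import structures.
From mathcomp Require Import all_boot all_order all_algebra.
From mathcomp Require Import all_classical all_reals all_analysis.
From mathcomp Require Import measurable_realfun ring lra.

Set Implicit Arguments.
Unset Strict Implicit.
Unset Printing Implicit Defensive.

Import Order.TTheory GRing.Theory Num.Theory.
Import numFieldNormedType.Exports.

Local Open Scope classical_set_scope.
Local Open Scope ring_scope.

(** * Flat functions and a smooth compactly supported bump *)

(** Keeping the power s^(-k) as a parameter makes the span of these functions stable under
    differentiation. *)
Definition flat (R : realType) (k : nat) (s : R) : R :=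
  if 0 < s then s^-1 ^+ k * expR (- s^-1) else 0.

Lemma flat_le0 (R : realType) (k : nat) (s : R) : s <= 0 -> flat k s = 0.
Proof. by rewrite /flat leNgt => /negbTE ->. Qed.

Lemma flatS (R : realType) (k : nat) (s : R) : flat k s = s * flat k.+1 s.
Proof.
rewrite /flat; case: ifPn => [s0|_]; last by rewrite mulr0.
by rewrite exprS !mulrA mulfV ?mul1r// gt_eqF.
Qed.

(** With w = 1/s, the term w^k / k! of the exponential series is at most exp(w). *)
Lemma flat_bounded (R : realType) (k : nat) (s : R) : `|flat k s| <= k`!%:R.
Proof.
rewrite /flat; case: ifPn => [s0|_]; last by rewrite normr0 ler0n.
have w0 : 0 <= s^-1 by rewrite invr_ge0 ltW.
rewrite ger0_norm; last by rewrite mulr_ge0 ?exprn_ge0 ?expR_ge0.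
rewrite expRN ler_pdivrMr ?expR_gt0// mulrC.
rewrite -ler_pdivrMr ?ltr0n ?fact_gt0//.
case: k => [|k].
  by rewrite expr0 fact0 divr1; apply: le_trans (expR_ge1Dx _); rewrite lerDl.
by apply: le_trans (expR_ge1Dxn k w0); rewrite lerDr.
Qed.

Lemma is_derive_flat (R : realType) (k : nat) (s : R) :
  is_derive s (1 : R) (@flat R k) (flat k.+2 s - k%:R * flat k.+1 s).
Proof.
have [s0|s0|->] := ltgtP s 0.
- rewrite !flat_le0 1?ltW// mulr0 subr0.
  apply: (near_eq_is_derive _ (is_derive_cst (0 : R) s 1)).
  near=> t; rewrite flat_le0// ltW//; near: t.
  exact: lt_nbhsl.
- pose g := (fun t : R => t^-1 ^+ k * expR (- t^-1)).
  have gE : \near s, g s = flat k s.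
    near=> t; rewrite /flat ifT//; near: t.
    exact: lt_nbhsr.
  apply: (near_eq_is_derive gE).
  have sn0 : (id s : R) != 0 by rewrite gt_eqF.
  have dV : is_derive s (1 : R) (fun t : R => t^-1) (- s ^- 2 *: (1 : R)).
    exact: (is_deriveV sn0).
  have dN : is_derive s (1 : R) (fun t : R => - t^-1) _ := is_deriveN dV.
  have dE : is_derive s (1 : R) (fun t : R => expR (- t^-1)) _ :=
    @is_derive1_comp R expR (fun t => - t^-1) s _ _ (is_derive_expR _) dN.
  have dX : is_derive s (1 : R) (fun t : R => t^-1 ^+ k)
      ((k%:R * s^-1 ^+ k.-1) *: (- s ^- 2 *: (1 : R))).
    rewrite (_ : (fun _ => _) = (fun t : R => t^-1) ^+ k); last first.
      by rewrite exprfctE.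
    exact: is_deriveX.
  have dg := is_deriveM dX dE.
  apply: (is_derive_eq dg).
  rewrite /flat s0 /= /GRing.scale /=.
  have -> : (s ^- 2 : R) = s^-1 ^+ 2 by rewrite exprVn.
  case: (k) => [|j] /=; rewrite ?exprS ?expr0; ring.
- (* Caratheodory's slope function at 0 is [flat k.+1], by [flatS]. *)
  rewrite !flat_le0// mulr0 subr0; apply/is_derive1_caratheodory.
  exists (flat k.+1); split; last by rewrite flat_le0.
    by move=> z; rewrite (flat_le0 _ (lexx _)) !subr0 mulrC -flatS.
  apply/cvgrPdist_le => /= e e0.
  have M0 : 0 < (k.+2)`!%:R :> R by rewrite ltr0n fact_gt0.
  (* By [flatS] the slope is z times a function bounded by (k+2)!, so it tends to 0. *)
  near=> z; rewrite [X in `|X - _|]flat_le0// sub0r normrN flatS normrM.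
  rewrite (le_trans (ler_wpM2l (normr_ge0 _) (flat_bounded _ _)))//.
  rewrite -ler_pdivlMr// -[z]opprK normrN -[- z]sub0r; near: z.
  by apply: (@cvgr_dist_le _ _ _ _ _ id 0); [exact: cvg_id|exact: divr_gt0].
Unshelve. all: by end_near. Qed.

Definition bump_base (R : realType) : {poly R} := 1 - 'X^2.

(** With u = 1 - t^2, differentiating P(t) [flat (2m)](u) gives P' [flat (2m)](u) + P u'
    ([flat (2m+2)](u) - 2m [flat (2m+1)](u)). Factoring out [flat (2m+2)](u) by [flatS] leaves this
    recurrence. *)
Fixpoint bump_poly (R : realType) (n : nat) : {poly R} :=
  if n is m.+1 then
    (bump_poly R m)^`() * bump_base R ^+ 2
    + (1 - (2 * m)%:R * bump_base R) * bump_poly R m * (bump_base R)^`()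
  else 1.

(* The n-th derivative of exp(-1/(1 - t^2)) extended by 0 off ]-1, 1[; every
   derivative has this shape because s^2 * flat (k + 2) s = flat k s. *)
Definition bump (R : realType) (n : nat) (t : R) : R :=
  (bump_poly R n).[t] * flat (2 * n) (bump_base R).[t].

Lemma is_derive_bump (R : realType) (n : nat) (t : R) :
  is_derive t (1 : R) (bump n) (bump n.+1 t).
Proof.
have dg := is_deriveM (is_derive_poly (bump_poly R n) t)
  (is_derive1_comp (is_derive_flat (2 * n) (bump_base R).[t])
     (is_derive_poly (bump_base R) t)).
apply: (is_derive_eq dg).
rewrite /bump [bump_poly R n.+1]/= mulnS add2n /GRing.scale /=.
rewrite (flatS (2 * n)) (flatS (2 * n).+1).
rewrite !(hornerD, hornerM, hornerN, hornerMn, horner_exp, hornerX, hornerC).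
ring.
Qed.

Lemma bump_eq0 (R : realType) (n : nat) (t : R) : 1 <= `|t| -> bump n t = 0.
Proof.
move=> t1; rewrite /bump flat_le0 ?mulr0//.
rewrite !hornerE subr_le0 -[t ^+ 2]real_normK ?num_real//.
by rewrite exprn_ege1.
Qed.

Lemma bump_bounded (R : realType) (n : nat) :
  exists2 M : R, 0 < M & forall t, `|bump n t| <= M.
Proof.
have cb : {within `[(-1 : R), 1], continuous (fun t => `|bump n t|)}.
  apply: continuous_subspaceT => t.
  apply: continuous_comp; last exact: norm_continuous.
  apply: differentiable_continuous; apply/derivable1_diffP.
  by have [] := is_derive_bump n t.
have [|c cI cM] := EVT_max _ cb; first lra.
exists (`|bump n c| + 1) => [|t]; first by rewrite ltr_wpDl.
have [t1|t1] := leP 1 `|t|; first by rewrite bump_eq0// normr0 addr_ge0.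
rewrite (le_trans (cM t _)) ?lerDl//.
by rewrite in_itv/=; move: t1; rewrite ltr_norml => /andP[/ltW-> /ltW->].
Qed.

(** This constant is the value of f_x found near every point of E. At 1/2 the base 1 - t^2 is
    positive with derivative -1, so both factors are nonzero. *)
Lemma bump_half_neq0 (R : realType) : bump 0 (2^-1 : R) * bump 1 2^-1 != 0.
Proof.
have u0 : 0 < 1 - 2^-1 ^+ 2 :> R by lra.
have du : (bump_base R)^`().[2^-1] = -1.
  rewrite /bump_base derivB derivXn -polyC1 derivC sub0r hornerN hornerMn.
  by rewrite expr1 hornerX -[X in - X]mulr_natl mulfV.
rewrite /bump /flat /= !hornerE /= u0 du.
rewrite -polyC1 derivC horner0 !mul0r add0r subr0 mul1r.
by rewrite !mulf_neq0 ?expf_neq0 ?invr_eq0 ?oppr_eq0 ?oner_eq0 ?gt_eqF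
  ?expR_gt0.
Qed.

(** The n-th derivative of the bump transported to the ball of centre c and radius d. *)
Definition scaled_bump (R : realType) (c d : R) (n : nat) (t : R) : R :=
  d^-1 ^+ n * bump n ((t - c) / d).

Lemma is_derive_scaled_bump (R : realType) (c d : R) (n : nat) (t : R) :
  is_derive t (1 : R) (scaled_bump c d n) (scaled_bump c d n.+1 t).
Proof.
have dl : is_derive t (1 : R) (fun t => (t - c) / d) d^-1.
  rewrite (_ : (fun _ => _) = d^-1 \*: (id - cst c)); last first.
    by apply/funext => z; rewrite /= mulrC.
  apply: (is_derive_eq (is_deriveZ d^-1
    (is_deriveB (is_derive_id t 1) (is_derive_cst c t 1)))).
  by rewrite subr0 /GRing.scale /= mulr1.
have dg := is_deriveZ (d^-1 ^+ n) (@is_derive1_comp R (@bump R n)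
  (fun t => (t - c) / d) t _ _ (is_derive_bump n _) dl).
by apply: (is_derive_eq dg); rewrite /scaled_bump exprS /GRing.scale /=; ring.
Qed.

Lemma scaled_bump_eq0 (R : realType) (c d : R) (n : nat) (t : R) :
  0 < d -> d <= `|t - c| -> scaled_bump c d n t = 0.
Proof.
move=> d0 dt; rewrite /scaled_bump bump_eq0 ?mulr0//.
by rewrite normrM normfV (gtr0_norm d0) ler_pdivlMr// mul1r.
Qed.

(** * Derivatives within a domain, computed from two-sided ones *)

Lemma is_derive_slopes_within (R : realType) (D : set R) (g : R -> R)
    (x l : R) :
  is_derive x (1 : R) g l -> slopes_within D g x --> l.
Proof.
move=> /is_derive1_caratheodory[G [gG cG <-]].
have cG' : G y @[y --> within D x^'] --> G x.
  by apply: cvg_within_filter; apply: cvg_within_filter.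
apply: cvg_trans cG'; apply: near_eq_cvg; near=> y.
rewrite gG mulfK// subr_eq0.
by near: y; apply: cvg_within; exact: withinT.
Unshelve. all: by end_near. Qed.

(** Properness makes limits unique, so that [lim] in [derive_within] returns the derivative. *)
Lemma within_dnbhs_proper (R : realType) (D : set R) (x : R) :
  limit_point D x -> ProperFilter (within D x^').
Proof.
move=> Dx; apply: Build_ProperFilter_ex => P /Dx[y [yx Dy /=]].
by move=> /(_ yx Dy); exists y.
Qed.

Lemma eq_slopes_within (R : realType) (D : set R) (g h : R -> R) (x : R) :
  D x -> {in D, g =1 h} -> slopes_within D g x = slopes_within D h x.
Proof.
move=> Dx gh.
have sub (u v : R -> R) : {in D, u =1 v} ->
    slopes_within D u x `=>` slopes_within D v x.
  move=> uv; apply: near_eq_cvg; near=> y.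
  rewrite !uv ?inE//.
  by near: y; exact: withinT.
by apply/seteqP; split; apply: sub => // z zD; rewrite gh.
Unshelve. all: by end_near. Qed.

Section derivative_sequence.
Variables (R : realType) (D : set R) (G : nat -> R -> R).
Hypothesis limD : D `<=` limit_point D.
Hypothesis dG : forall n x, is_derive x (1 : R) (G n) (G n.+1 x).

(** The equality is claimed on D only; this suffices for the induction because slopes at a point of
    D read values on D alone. *)
Lemma deriven_withinE (n : nat) : {in D, deriven_within D n (G 0) =1 G n}.
Proof.
elim: n => [//|n IHn] x /set_mem Dx.
rewrite /deriven_within iterS -/(deriven_within D n (G 0)) /derive_within.
rewrite (eq_slopes_within Dx IHn).
have := within_dnbhs_proper (limD Dx) => ?.
by apply/cvg_lim => //; exact: is_derive_slopes_within.
Qed.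

Lemma smooth_within_derivs : smooth_within D (G 0).
Proof.
move=> n x Dx; rewrite /derivable_within.
rewrite (eq_slopes_within Dx (deriven_withinE n)).
by apply/cvg_ex; exists (G n.+1 x); exact: is_derive_slopes_within.
Qed.

End derivative_sequence.

Lemma unit_itv_limit_point (R : realType) :
  unit_itv R `<=` limit_point (unit_itv R).
Proof.
rewrite /unit_itv => x; rewrite /= in_itv/= => /andP[x0 x1] U.
move=> /nbhs_ballP[e /= e0 xU].
(* A step of length at most 1/2 stays in [0, 1] when taken rightwards from x <= 1/2 and leftwards
   otherwise. *)
have [h [h0 he h1]] : exists h, [/\ 0 < h, h < e & h <= 2^-1].
  exists (Num.min (e / 2) 2^-1); split.
  - by rewrite lt_min divr_gt0//= invr_gt0.
  - by rewrite gt_min; apply/orP; left; lra.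
  - by rewrite ge_min lexx orbT.
have [xh|xh] := leP x 2^-1.
- exists (x + h); split; first by rewrite gt_eqF// ltrDl.
    by rewrite /= in_itv/=; apply/andP; split; lra.
  by apply: xU; rewrite /ball/= opprD addNKr normrN gtr0_norm.
- exists (x - h); split; first by rewrite lt_eqF// gtrBl.
    by rewrite /= in_itv/=; apply/andP; split; lra.
  by apply: xU; rewrite /ball/= opprB addrC subrK gtr0_norm.
Qed.

(** * Greedy choice of disjoint balls off K *)

Lemma closed_norm_ball (R : realType) (a d : R) :
  closed [set t : R | `|t - a| <= d].
Proof.
rewrite (_ : [set _ | _] = (fun t => `|t - a|) @^-1` [set x | x <= d])//.
apply: preimage_closed; last exact: closed_le.
by move=> t _; apply: cvg_norm; apply: cvgB; [exact: cvg_id|exact: cvg_cst].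
Qed.

Lemma ball_avoiding (R : realType) (K F : set R) (p e : R) :
  closed K -> closed F -> dense (~` K) -> ~ F p -> 0 < e ->
  exists a d : R, 0 < d /\
    forall t, `|t - a| <= d -> [/\ `|t - p| < e, ~ F t & ~ K t].
Proof.
move=> cK cF dK Fp e0.
have oO : open (ball p e `&` ~` F).
  by apply: openI; [exact: ball_open|exact: closed_openC].
have [|a [aO aK]] := dK (ball p e `&` ~` F) _ oO.
  by exists p; split => //; exact: ballxx.
have /nbhs_ballP[r /= r0 aU] : nbhs a (ball p e `&` ~` F `&` ~` K).
  by apply: open_nbhs_nbhs; split=> //; apply: openI => //; exact: closed_openC.
(* Halving fits a closed ball into the open one of radius r. *)
exists a, (r / 2); split=> [|t ta]; first by rewrite divr_gt0.
have [|[tp tF] tK] := aU t.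
  by rewrite /ball/= distrC (le_lt_trans ta)//; lra.
by split=> //; rewrite distrC.
Qed.

(** The first ball is added to the forbidden set before choosing the second; q stays allowed since
    the first ball misses K. Shrinking both to the smaller radius preserves everything. *)
Lemma ball_pair_avoiding (R : realType) (K F : set R) (p q e : R) :
  closed K -> closed F -> dense (~` K) -> K `<=` ~` F -> K p -> K q -> 0 < e ->
  exists a b d : R, [/\ 0 < d,
    forall t, `|t - a| <= d -> [/\ `|t - p| < e, ~ F t & ~ K t],
    forall t, `|t - b| <= d -> [/\ `|t - q| < e, ~ F t & ~ K t]
    & forall t, `|t - a| <= d -> ~ `|t - b| <= d].
Proof.
move=> cK cF dK KF Kp Kq e0.
have [a [d1 [d10 aP]]] := ball_avoiding cK cF dK (KF _ Kp) e0.
have cF' : closed (F `|` [set t | `|t - a| <= d1]).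
  by apply: closedU => //; exact: closed_norm_ball.
have qF' : ~ (F `|` [set t | `|t - a| <= d1]) q.
  by case=> [/(KF _ Kq)//|/aP[_ _]]; exact.
have [b [d2 [d20 bP]]] := ball_avoiding cK cF' dK qF' e0.
have dl t x y z : `|t - x| <= Num.min y z :> R ->
    `|t - x| <= y /\ `|t - x| <= z.
  by rewrite le_min => /andP.
exists a, b, (Num.min d1 d2); split.
- by rewrite lt_min d10.
- by move=> t /dl[/aP].
- by move=> t /dl[_ /bP[? /not_orP[]]].
- by move=> t /dl[ta _] /dl[_ /bP[_ /not_orP[_]]].
Qed.

Lemma dense_targets (R : realType) (K : set R) : K !=set0 ->
  exists s : nat -> R * R * R,
    (forall n, [/\ K (s n).1.1, K (s n).1.2 & 0 < (s n).2]) /\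
    forall p q r : R, K p -> K q -> 0 < r -> exists n,
      (forall t, `|t - (s n).1.1| < (s n).2 -> `|t - p| < r) /\
      (forall t, `|t - (s n).1.2| < (s n).2 -> `|t - q| < r).
Proof.
move=> [p0 Kp0].
(* Targets must lie in K, which may contain no rational: each rational u and precision 1/(k+1)
   selects a point of K that close to u if there is one, and [p0] otherwise. The triples (u, v, k)
   are then enumerated. *)
pose near_rat (u : rat) (k : nat) :=
  [set p : R | K p /\ `|p - ratr u| < k.+1%:R^-1].
pose pt u k :=
  if pselect (near_rat u k !=set0) then xget p0 (near_rat u k) else p0.
have Kpt u k : K (pt u k).
  by rewrite /pt; case: pselect => // x; have [] := xgetPex p0 x.
pose s n := let: (u, v, k) := odflt (0%Q, 0%Q, 0%N) (unpickle n) in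
  (pt u k, pt v k, k.+1%:R^-1 : R).
exists s; split=> [n|p q r Kp Kq r0].
  by rewrite /s; case: (odflt _ _) => -[u v] k /=; split; rewrite ?invr_gt0.
(* Three errors below 1/(k+1) < r/3 add up: from t to the target, to the rational u, to x. *)
have r30 : 0 < r / 3 by rewrite divr_gt0.
have [k kr] := ltr_add_invr r30; rewrite add0r in kr.
have approx x : K x -> exists u, forall t,
    `|t - pt u k| < k.+1%:R^-1 -> `|t - x| < r.
  move=> Kx.
  have k0 : 0 < k.+1%:R^-1 :> R by rewrite invr_gt0.
  have [|z [xz [u _ zu]]] := dense_rat _ (ball_open x k.+1%:R^-1).
    by exists x; exact: ballxx.
  have xu : `|x - ratr u| < k.+1%:R^-1 by rewrite zu; exact: xz.
  exists u => t; rewrite /pt; case: pselect => [h|[]]; last by exists x.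
  have [_ h2] := xgetPex p0 h => h1.
  move: kr h1 h2 xu; rewrite /= !ltr_norml.
  move: (xget _ _) (k.+1%:R^-1 : R) => y w ?.
  by move=> /= /andP[? ?] /andP[? ?] /andP[? ?]; apply/andP; split; lra.
have [[u uP] [v vP]] := (approx _ Kp, approx _ Kq).
by exists (pickle (u, v, k)); rewrite /s pickleK.
Qed.

Lemma paired_balls (R : realType) (K : set R) :
  closed K -> dense (~` K) -> K !=set0 -> K `<=` `]0, 1[ ->
  exists (c : nat * bool -> R) (d : nat -> R), [/\ forall n, 0 < d n,
    forall m m' t, `|t - c m| <= d m.1 -> `|t - c m'| <= d m'.1 -> m = m',
    forall m t, `|t - c m| <= d m.1 -> ~ K t /\ 0 < t < 1
    & forall p q r : R, K p -> K q -> 0 < r -> exists n,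
      (forall t, `|t - c (n, true)| <= d n -> `|t - p| < r) /\
      (forall t, `|t - c (n, false)| <= d n -> `|t - q| < r)].
Proof.
move=> cK dK K0 K01.
have [s [sP s_dense]] := dense_targets K0.
pose good (F : set R) (n : nat) (x : R * R * R) := [/\ 0 < x.2,
    forall t, `|t - x.1.1| <= x.2 ->
      [/\ `|t - (s n).1.1| < (s n).2, ~ F t & ~ K t],
    forall t, `|t - x.1.2| <= x.2 ->
      [/\ `|t - (s n).1.2| < (s n).2, ~ F t & ~ K t]
    & forall t, `|t - x.1.1| <= x.2 -> ~ `|t - x.1.2| <= x.2].
have /choice[g gP] : forall Fn : set R * nat, exists x : R * R * R,
    closed Fn.1 -> K `<=` ~` Fn.1 -> good Fn.1 Fn.2 x.
  move=> [F n] /=.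
  have [[cF KF]|h] := pselect (closed F /\ K `<=` ~` F); last first.
    (* A dummy value, so that [choice] yields a total function that the recursion below can call
       before its invariant is known. *)
    by exists (0, 0, 0) => cF KF; exfalso; apply: h.
  have [sp sq se] := sP n.
  have [a [b [d H]]] := ball_pair_avoiding cK cF dK KF sp sq se.
  by exists (a, b, d).
(* [F n] collects all balls chosen before step n; starting from the complement of ]0, 1[ confines
   the balls to that interval. *)
pose fix F n : set R := if n is m.+1 then
    F m `|` [set t | `|t - (g (F m, m)).1.1| <= (g (F m, m)).2]
        `|` [set t | `|t - (g (F m, m)).1.2| <= (g (F m, m)).2]
  else ~` `]0, 1[.
have Finv n : closed (F n) /\ K `<=` ~` F n.
  elim: n => [|n [cF KF]] /=.
    split; first by apply: open_closedC; exact: interval_open.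
    by rewrite setCK.
  split; first by do 2 (apply: closedU; last exact: closed_norm_ball).
  have [_ aP bP _] := gP (F n, n) cF KF.
  by move=> t Kt [[/(KF _ Kt)|/aP[_ _]]|/bP[_ _]].
have good_n n : good (F n) n (g (F n, n)) by have [? ?] := Finv n; exact: gP.
have Fmono m n : (m <= n)%N -> F m `<=` F n.
  elim: n => [|n IHn]; first by rewrite leqn0 => /eqP ->.
  by rewrite leq_eqVlt => /predU1P[->//|/IHn mn] t /mn; left; left.
pose c m := let x := (g (F m.1, m.1)).1 in if m.2 then x.1 else x.2.
pose d n := (g (F n, n)).2.
(* A point of a ball enters the increasing sets [F] exactly at the step following its choice, so it
   determines the index of the pair. *)
have cP m t : `|t - c m| <= d m.1 -> [/\ ~ F m.1 t, F m.1.+1 t & ~ K t].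
  have [_ aP bP _] := good_n m.1; rewrite /c; case: m aP bP => n [] /= aP bP tm.
  - by have [_ ? ?] := aP _ tm; split=> //; left; right.
  - by have [_ ? ?] := bP _ tm; split=> //; right.
exists c, d; split.
- by move=> n; have [] := good_n n.
- move=> m m' t tm tm'.
  have [F1 F2 _] := cP _ _ tm; have [F1' F2' _] := cP _ _ tm'.
  have E : m.1 = m'.1.
    by case: (ltngtP m.1 m'.1) => // /Fmono => [/(_ _ F2)|/(_ _ F2')].
  have [_ _ _ D] := good_n m.1.
  case: m m' tm tm' E D {F1 F2 F1' F2'} => [n b] [n' b'] /= + + E; rewrite -E.
  by case: b; case: b' => // tm tm' D; [case: (D _ tm tm')|case: (D _ tm' tm)].
- move=> m t tm; have [F1 _ tK] := cP _ _ tm; split=> //.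
  have : ~ F 0%N t by move=> /(Fmono _ _ (leq0n m.1)).
  by move=> /contrapT; rewrite /= in_itv.
- move=> p q r Kp Kq r0; have [n [np nq]] := s_dense _ _ _ Kp Kq r0.
  have [_ aP bP _] := good_n n.
  by exists n; split=> t /=; [move=> /aP[/np]|move=> /bP[/nq]].
Qed.

(** * A compact set of irrationals of positive measure *)

Lemma unit_itv_compact_dense_compl (R : realType) : exists K : set R,
  [/\ compact K, K `<=` `]0, 1[, dense (~` K) & (0 < @lebesgue_measure R K)%E].
Proof.
pose I : set R := [set` `]0, 1[]; pose Q : set R := range ratr.
pose D := I `\` Q.
have mI : measurable I by exact: measurable_itv.
have mQ : measurable Q.
  apply: countable_measurable => //.
  exact: (card_le_trans (card_image_le _ _) (countableP _)).
have mD : measurable D by exact: measurableD.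
have D1 : lebesgue_measure D = 1%E.
  have : lebesgue_measure I =
      (lebesgue_measure D + lebesgue_measure (I `&` Q))%E.
    exact: measureDI.
  rewrite [X in (_ + X)%E](_ : _ = 0%E).
    by rewrite adde0 lebesgue_measure_itv/= lte01 oppr0 adde0 => <-.
  apply: subset_measure0 (lebesgue_measure_rat R) => //.
  exact: measurableI.
(* The irrationals of ]0, 1[ have measure 1, so losing less than 1/2 leaves positive measure.
   Avoiding the rationals gives K a dense complement. *)
have [||K [cK KD DK]] := @lebesgue_regularity_inner R D 2^-1 mD.
- by rewrite [X in (X < _)%E]D1 ltry.
- by rewrite invr_gt0.
exists K; split => //.
- by move=> t /KD[].
- move=> O O0 oO; have [z [Oz [u _ uz]]] := dense_rat O0 oO.
  by exists z; split=> // /KD[_]; apply; exists u.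
- rewrite lt0e measure_ge0 andbT; apply/eqP => K0.
  have mK : measurable K by exact: compact_measurable.
  have : lebesgue_measure D =
      (lebesgue_measure (D `\` K) + lebesgue_measure (D `&` K))%E.
    exact: measureDI.
  rewrite D1 [X in (_ + X)%E](_ : _ = 0%E).
    rewrite adde0 => /esym E; move: DK.
    by rewrite [X in (X < _)%E]E lte_fin; lra.
  by apply: subset_measure0 K0 => //; exact: measurableI.
Qed.

(** * The function assembled from paired bumps *)

Section paired_bumps.
Variables (R : realType) (K : set R) (c : nat * bool -> R) (d : nat -> R).
Hypothesis d0 : forall n, 0 < d n.
Hypothesis ball_inj : forall m m' t,
  `|t - c m| <= d m.1 -> `|t - c m'| <= d m'.1 -> m = m'.
Hypothesis ball_itv : forall m t, `|t - c m| <= d m.1 -> ~ K t /\ 0 < t < 1.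
Hypothesis ball_dense : forall p q r : R, K p -> K q -> 0 < r -> exists n,
  (forall t, `|t - c (n, true)| <= d n -> `|t - p| < r) /\
  (forall t, `|t - c (n, false)| <= d n -> `|t - q| < r).

Definition partner (m : nat * bool) := (m.1, ~~ m.2).

(* The n-th derivative in x of f(x, y). When [y] lies in no ball, the index
   is an arbitrary default; the factor [scaled_bump _ _ 0 y] then vanishes. *)
Definition slice (y : R) (n : nat) (x : R) : R :=
  let m := xget (0%N, true) [set m | `|y - c m| <= d m.1] in
  d m.1 * scaled_bump (c m) (d m.1) 0 y
    * scaled_bump (c (partner m)) (d m.1) n x.

Definition paired_bumps (p : R * R) : R := slice p.2 0 p.1.

Lemma sliceE (m : nat * bool) (y : R) (n : nat) (x : R) : `|y - c m| <= d m.1 ->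
  slice y n x = d m.1 * scaled_bump (c m) (d m.1) 0 y
    * scaled_bump (c (partner m)) (d m.1) n x.
Proof.
move=> ym; rewrite /slice (@xget_subset1 _ _ _ m)//.
by move=> m1 m2; exact: ball_inj.
Qed.

Lemma slice_eq0 (y : R) (n : nat) (x : R) :
  ~ (exists m, `|y - c m| <= d m.1 /\ `|x - c (partner m)| <= d m.1) ->
  slice y n x = 0.
Proof.
rewrite /slice; set m := xget _ _ => h.
have [ym|ym] := leP `|y - c m| (d m.1); last first.
  by rewrite scaled_bump_eq0 ?(ltW ym)// mulr0 mul0r.
rewrite [X in _ * X]scaled_bump_eq0 ?mulr0// leNgt; apply/negP => xm.
by apply: h; exists m; split=> //; exact: ltW.
Qed.

(** Exchanging x and y replaces the index by its partner, which has the same radius. *)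
Lemma paired_bumpsC (x y : R) : paired_bumps (x, y) = paired_bumps (y, x).
Proof.
rewrite /paired_bumps /=.
have [[m [ym xm]]|h] := pselect (exists m,
    `|y - c m| <= d m.1 /\ `|x - c (partner m)| <= d m.1).
  rewrite (sliceE _ _ ym) (@sliceE (partner m))// /partner /= negbK.
  by rewrite -surjective_pairing mulrAC.
rewrite !slice_eq0// => -[m [xm ym]]; apply: h.
by exists (partner m); rewrite /partner /= negbK -surjective_pairing.
Qed.

(** The chosen index depends on y alone, so in x the slice is a constant multiple of one scaled
    bump. *)
Lemma is_derive_slice (y : R) (n : nat) (x : R) :
  is_derive x (1 : R) (slice y n) (slice y n.+1 x).
Proof. by rewrite /slice; apply: is_deriveZ; exact: is_derive_scaled_bump. Qed.

Lemma partialx_paired_bumps (n : nat) (x y : R) : unit_itv R x ->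
  partialx n paired_bumps (x, y) = slice y n x.
Proof.
move=> /mem_set x01.
exact: (deriven_withinE (@unit_itv_limit_point R) (is_derive_slice y)).
Qed.

Lemma partialy_paired_bumps (n : nat) (x y : R) :
  partialy n paired_bumps (x, y) = partialx n paired_bumps (y, x).
Proof.
by rewrite /partialx /partialy /=; congr deriven_within; apply/funext => z;
  exact: paired_bumpsC.
Qed.

Lemma separately_smooth_paired_bumps : separately_smooth paired_bumps.
Proof.
have smooth_slice y : smooth_within (unit_itv R) (slice y 0).
  exact: smooth_within_derivs (@unit_itv_limit_point R) (is_derive_slice y).
split=> z _; first exact: smooth_slice.
rewrite (_ : (fun _ => _) = slice z 0) //.
by apply/funext => x; rewrite paired_bumpsC.
Qed.

(** The amplitude d, the factor d^(-2) of a second derivative and the length 2d of the support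
    cancel, leaving 2 M0 M2 for every y. *)
Lemma integral_slice_bounded : exists C : R, forall y,
  (\int[lebesgue_measure]_(x in unit_itv R) `|slice y 2 x|%:E <= C%:E)%E.
Proof.
have [M0 M0_gt0 bM0] := bump_bounded R 0.
have [M2 M2_gt0 bM2] := bump_bounded R 2.
exists (2 * M0 * M2) => y.
set m := xget (0%N, true) [set m | `|y - c m| <= d m.1].
set a := c (partner m); pose A : set R := [set` `[a - d m.1, a + d m.1]].
have dm0 := d0 m.1; have dmn0 : d m.1 != 0 by rewrite gt_eqF.
have le_slice x : `|slice y 2 x| <= (d m.1)^-1 * M0 * M2 * \1_A x.
  rewrite indicE; case: (boolP (x \in A)) => [_|xA].
    rewrite mulr1 /slice -/m /scaled_bump expr0 mul1r.
    have := bM2 ((x - c (partner m)) / d m.1); have := bM0 ((y - c m) / d m.1).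
    move: (bump 0 _) (bump 2 _) => u v uM vM.
    rewrite !normrM !normfV (gtr0_norm dm0).
    rewrite [leRHS](_ : _ = d m.1 * M0 * ((d m.1)^-1 * (d m.1)^-1 * M2));
      last by field.
    have dV0 : 0 < (d m.1)^-1 by rewrite invr_gt0.
    apply: ler_pM.
    - by apply: mulr_ge0 => //; exact: ltW.
    - by apply: mulr_ge0 => //; apply: mulr_ge0; exact: ltW.
    - by apply: ler_wpM2l => //; exact: ltW.
    - by apply: ler_wpM2l => //; apply: mulr_ge0; exact: ltW.
  rewrite mulr0 normr_le0 /slice -/m [X in _ * X]scaled_bump_eq0 ?mulr0//.
  rewrite leNgt; apply: contra xA => /ltW; rewrite ler_distl => xa.
  by rewrite inE /A /= in_itv.
have mslice : measurable_fun (unit_itv R) (slice y 2).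
  apply: measurable_funTS; apply: continuous_measurable_fun => x.
  apply: differentiable_continuous; apply/derivable1_diffP.
  by have [] := is_derive_slice y 2 x.
have mI : measurable (unit_itv R) by exact: measurable_itv.
have mA : measurable A by exact: measurable_itv.
apply: (@le_trans _ _ (\int[lebesgue_measure]_(x in unit_itv R)
    ((d m.1)^-1 * M0 * M2 * \1_A x)%:E)%E).
  apply: ge0_le_integral => //.
  - by apply/measurable_EFinP; apply: measurableT_comp.
  - apply/measurable_EFinP; exact: measurable_realfun.measurable_funM.
  - by move=> x _; rewrite lee_fin.
under eq_integral do rewrite EFinM.
rewrite ge0_integralZl_EFin//; first last.
- by rewrite !mulr_ge0// ?invr_ge0 ltW.
- by apply/measurable_EFinP; exact: measurable_indic.
rewrite integral_indic//.
apply: (@le_trans _ _ (((d m.1)^-1 * M0 * M2)%:E * lebesgue_measure A)%E).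
  apply: lee_wpmul2l.
    by rewrite lee_fin !mulr_ge0// ?invr_ge0 ltW.
  by apply: le_measure; rewrite ?inE//; exact: measurableI.
rewrite lebesgue_measure_itv/= lte_fin ifT; last by lra.
rewrite -EFinB -EFinM lee_fin le_eqVlt; apply/orP; left; apply/eqP; field.
exact: dmn0.
Qed.

(** No ball meets K, so f vanishes on the whole horizontal line at a height in K. *)
Lemma partialx_K_eq0 (p : R * R) : unit_itv R p.1 -> K p.2 ->
  partialx 1 paired_bumps p = 0.
Proof.
case: p => x y /= x01 Ky; rewrite partialx_paired_bumps// slice_eq0//.
by move=> [m [ym _]]; have [] := ball_itv ym.
Qed.

Lemma partialx_not_small (p : R * R) (r : R) : K p.1 -> K p.2 -> 0 < r ->
  exists q, [/\ unit_square R q, `|q.1 - p.1| < r, `|q.2 - p.2| < r &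
    partialx 1 paired_bumps q = bump 0 2^-1 * bump 1 2^-1].
Proof.
move=> Kp1 Kp2 r0; have [n [nx ny]] := ball_dense Kp1 Kp2 r0.
have dn0 := d0 n; have dnn0 : d n != 0 by rewrite gt_eqF.
have half m : `|c m + d n / 2 - c m| <= d n.
  by rewrite addrC addKr ger0_norm; lra.
have itv m : m.1 = n -> unit_itv R (c m + d n / 2).
  move=> mn; have [|_ /andP[? ?]] := @ball_itv m (c m + d n / 2).
    by rewrite mn; exact: half.
  by rewrite /unit_itv /= in_itv /= !ltW.
(* Both rescaled coordinates equal 1/2, and the amplitude d cancels the 1/d of the first
   derivative. *)
exists (c (n, true) + d n / 2, c (n, false) + d n / 2); split => /=.
- by split; apply: itv.
- exact/nx/half.
- exact/ny/half.
rewrite partialx_paired_bumps; last exact: itv.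
rewrite (@sliceE (n, false)) /=; last exact: half.
rewrite /scaled_bump /partner /= expr0 expr1 mul1r.
have tE m : (c m + d n / 2 - c m) / d n = 2^-1.
  by rewrite addrC addKr mulrAC mulfV// mul1r.
rewrite !tE; field.
exact: dnn0.
Qed.

End paired_bumps.

(** * Joint discontinuity, equality of the suprema, and conclusion *)

Lemma jointly_discontinuous_of_not_small (R : realType) (g : R * R -> R)
    (p : R * R) (e : R) :
  e != 0 -> g p = 0 ->
  (forall r, 0 < r -> exists q,
    [/\ unit_square R q, `|q.1 - p.1| < r, `|q.2 - p.2| < r & g q = e]) ->
  jointly_discontinuous_at g p.
Proof.
move=> e0 gp gq /cvgrPdist_lt /(_ `|e|); rewrite normr_gt0 => /(_ e0).
move=> /nbhs_ballP[r /= r0 h]; have [q [qD q1 q2 qe]] := gq r r0.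
have : `|g p - g q| < `|e|.
  by apply: h => //; split; rewrite /ball/= distrC.
by rewrite gp qe sub0r normrN ltxx.
Qed.

Lemma ereal_sup_integral_swap (R : realType) (f : R * R -> R) :
  (forall n x y, partialy n f (x, y) = partialx n f (y, x)) ->
  ereal_sup [set (\int[lebesgue_measure]_(x in unit_itv R)
                    `|partialx 2 f (x, y)|%:E)%E | y in unit_itv R]
  = ereal_sup [set (\int[lebesgue_measure]_(y in unit_itv R)
                      `|partialy 2 f (x, y)|%:E)%E | x in unit_itv R].
Proof.
move=> fC; set A := (X in ereal_sup X = _); set B := (X in _ = ereal_sup X).
suff -> : A = B by [].
by apply: eq_imagel => y _; apply: eq_integral => x _; rewrite fC.
Qed.

Theorem theorem5p1 (R : realType) :
  exists f : R * R -> R,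
    [/\ separately_smooth f,
        (ereal_sup [set (\int[lebesgue_measure]_(x in unit_itv R)
                           `|partialx 2 f (x, y)|%:E)%E | y in unit_itv R]
         = ereal_sup [set (\int[lebesgue_measure]_(y in unit_itv R)
                             `|partialy 2 f (x, y)|%:E)%E | x in unit_itv R])
        /\ (ereal_sup [set (\int[lebesgue_measure]_(y in unit_itv R)
                             `|partialy 2 f (x, y)|%:E)%E | x in unit_itv R]
            < +oo)%E
      & exists E : set (R * R),
          [/\ closed E,
              E `<=` unit_square R,
              (0 < (@lebesgue_measure R \x @lebesgue_measure R) E)%E
            & forall p, E p ->
                jointly_discontinuous_at (partialx 1 f) p /\
                jointly_discontinuous_at (partialy 1 f) p]].
Proof.
have [K [cK K01 dK muK]] := unit_itv_compact_dense_compl R.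
have clK : closed K by exact: compact_closed.
have mK : measurable K by exact: compact_measurable.
have K0 : K !=set0.
  by apply/set0P; apply: contraTneq muK => ->; rewrite measure0 ltxx.
have [c [d [d0 inj itv dns]]] := paired_balls clK dK K0 K01.
have KI : K `<=` unit_itv R.
  by apply: subset_trans K01 _; exact: subset_itv_oo_cc.
pose f := paired_bumps c d.
have fC n x y : partialy n f (x, y) = partialx n f (y, x).
  exact: partialy_paired_bumps.
exists f; split.
- exact: separately_smooth_paired_bumps.
- split.
    exact: ereal_sup_integral_swap.
  have [C hC] := integral_slice_bounded c d0.
  apply: (@le_lt_trans _ _ C%:E); last exact: ltry.
  apply: ge_ereal_sup => _ [y _ <-].
  rewrite (le_trans _ (hC y))// le_eqVlt; apply/orP; left; apply/eqP.
  by apply: eq_integral => x /set_mem x01; rewrite fC partialx_paired_bumps.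
- exists (K `*` K); split.
  + rewrite (_ : K `*` K = (fst @^-1` K) `&` (snd @^-1` K))//.
    apply: closedI; apply: preimage_closed => // z _.
      exact: cvg_fst.
    exact: cvg_snd.
  + by move=> p [/KI ? /KI].
  + by rewrite product_measure1E// mule_gt0.
  + move=> p [Kp1 Kp2]; have e0 := bump_half_neq0 R.
    split; apply: (jointly_discontinuous_of_not_small e0).
    * by apply: (partialx_K_eq0 d0 itv) => //; exact: KI.
    * by move=> r r0; exact: (partialx_not_small d0 inj itv dns).
    * case: p Kp1 Kp2 => x y /= Kx Ky; rewrite fC.
      by apply: (partialx_K_eq0 d0 itv) => //=; exact: KI.
    * move=> r r0.
      have [[u v] /= [[? ?] ? ? E]] :=
        @partialx_not_small _ _ _ _ d0 inj itv dns (p.2, p.1) r Kp2 Kp1 r0.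
      by exists (v, u); split; [split| | |rewrite -E; exact: fC].
Qed.
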